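(* Let $F:Q=[0,1]^3\to\mathbb R^3$ be any trilinear map (valid or not) with Jacobian determinant $J=\det(DF)$. For each of the six faces of $Q$, let $f:K=[0,1]^2\to\mathbb R$ be the restriction of $J$ to that face, and let $P$ and the candidate set $\mathcal C\subset K$ be the polynomial and set associated with $f$ as defined in the context. Then: (i) $P$ has degree at most $4$; (ii) $\mathcal C$ is finite: it contains at most eight perimeter candidates and at most four interior candidates; (iii) $\displaystyle\min_{(s,t)\in K}f(s,t)=\min_{(s,t)\in\mathcal C}f(s,t)$. Consequently $\min_{\partial Q}J$ is attained at a point of the finite set consisting of the candidate points of all six faces.
   Context: A map $F:Q\to\mathbb R^3$ is trilinear if it is affine in each of the coordinates $x,y,z$ separately. $DF=[\partial F/\partial x\mid\partial F/\partial y\mid\partial F/\partial z]$ and $J=\det(DF)$, a polynomial. Face restriction. On a face $x=x_0$ with $x_0\in\{0,1\}$ put $f(s,t)=J(x_0,s,t)$ for $(s,t)\in K=[0,1]^2$; on faces $y=y_0$ and $z=z_0$ (with $y_0,z_0\in\{0,1\}$) put $f(s,t)=J(s,y_0,t)$ and $f(s,t)=J(s,t,z_0)$ respectively. Every such $f$ has the form $$f(s,t)=a(t)s^2+b(t)s+c(t),\quad a(t)=a_0+a_1t,\quad b(t)=b_0+b_1t+b_2t^2,\quad c(t)=c_0+c_1t+c_2t^2,$$ with eight real coefficients determined by $F$ and the face. Polynomial $P$: $$P(t)=4a(t)^2c'(t)-2a(t)b(t)b'(t)+a'(t)b(t)^2 .$$ Candidate set $\mathcal C$. Perimeter candidates: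 the four corners of $K$, together with, for each of the four edges of $K$ parametrized by $r\in[0,1]$ as $(0,r)$, $(1,r)$, $(r,0)$, $(r,1)$, on which $f$ restricts to a polynomial $d_2r^2+d_1r+d_0$, the point of the edge with parameter $r_*=-d_1/(2d_2)$ whenever $d_2>0$ and $0<r_*<1$. Interior candidates: if $P$ is not the zero polynomial, all points $(s_*(t),t)$ where $t\in(0,1)$ is a real root of $P$ with $a(t)>0$ and $s_*(t)=-b(t)/(2a(t))$ satisfies $0<s_*(t)<1$. If $P$ is identically zero there are no interior candidates. $\mathcal C$ is the set of all perimeter and interior candidates. *)

(* Defs.v *)
From HB Require Import structures.
From mathcomp Require Import all_boot all_order all_algebra.
From mathcomp Require Import all_classical all_reals all_analysis.

Set Implicit Arguments.
Unset Strict Implicit.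
Unset Printing Implicit Defensive.

Import Order.TTheory GRing.Theory Num.Theory.
Import numFieldNormedType.Exports.

Local Open Scope classical_set_scope.
Local Open Scope ring_scope.

Definition cube (R : realType) : set 'rV[R]_3 :=
  [set p | forall i, 0 <= p 0 i <= 1].

Definition cube_boundary (R : realType) : set 'rV[R]_3 :=
  closure (@cube R) `\` interior (@cube R).

(* A map Q -> R^3 is represented by a total function of which only the values
   on Q = cube are ever used: all notions below depend on F through its
   restriction to Q. *)

Definition set_coord (R : realType) (p : 'rV[R]_3) (i : 'I_3) (u : R) :
    'rV[R]_3 :=
  \row_j (if j == i then u else p 0 j).

Definition trilinear (R : realType) (F : 'rV[R]_3 -> 'rV[R]_3) : Prop :=
  forall (p : 'rV[R]_3) (i : 'I_3), cube p ->
    exists A B : 'rV[R]_3,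
      forall u : R, 0 <= u <= 1 -> F (set_coord p i u) = A + u *: B.

(* Partial derivative at a point of Q, the increment being restricted so that
   the moved point stays in Q; it is one-sided at points of the boundary where
   the direction is transverse to a face. *)
Definition partial (R : realType) (F : 'rV[R]_3 -> 'rV[R]_3) (j : 'I_3)
    (p : 'rV[R]_3) : 'rV[R]_3 :=
  lim ((fun h : R => h^-1 *: (F (p + h *: delta_mx 0 j) - F p))
       @ within [set h : R | cube (p + h *: delta_mx 0 j)] 0^').

(* F takes values in row vectors; the partial derivatives are the columns. *)
Definition DF (R : realType) (F : 'rV[R]_3 -> 'rV[R]_3) (p : 'rV[R]_3) :
    'M[R]_3 :=
  \matrix_(i, j) (partial F j p) 0 i.

Definition Jac (R : realType) (F : 'rV[R]_3 -> 'rV[R]_3) (p : 'rV[R]_3) : R :=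
  \det (DF F p).

Definition point3 (R : realType) (x y z : R) : 'rV[R]_3 :=
  \row_(j < 3) [:: x; y; z]`_j.

(* The six faces x = e, y = e, z = e, with e : bool read as 0 or 1. *)
Inductive face : Type := FaceX of bool | FaceY of bool | FaceZ of bool.

Definition face_point (R : realType) (phi : face) (p : R * R) : 'rV[R]_3 :=
  match phi with
  | FaceX e => point3 e%:R p.1 p.2
  | FaceY e => point3 p.1 e%:R p.2
  | FaceZ e => point3 p.1 p.2 e%:R
  end.

Definition face_fun (R : realType) (F : 'rV[R]_3 -> 'rV[R]_3) (phi : face) :
    R * R -> R :=
  fun p => Jac F (face_point phi p).

Definition unit_square (R : realType) : set (R * R) :=
  [set p | 0 <= p.1 <= 1 /\ 0 <= p.2 <= 1].
Arguments unit_square : clear implicits.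

(* f = a(t) s^2 + b(t) s + c(t) on K with deg a <= 1, deg b <= 2, deg c <= 2.
   At most one triple (a, b, c) satisfies this for a given f, since a
   polynomial is determined by its values on [0,1]. *)
Definition face_coeffs (R : realType) (f : R * R -> R) (a b c : {poly R}) :
    Prop :=
  [/\ (size a <= 2)%N, (size b <= 3)%N, (size c <= 3)%N
    & forall s t : R, 0 <= s <= 1 -> 0 <= t <= 1 ->
        f (s, t) = a.[t] * s ^+ 2 + b.[t] * s + c.[t]].

Definition Ppoly (R : realType) (a b c : {poly R}) : {poly R} :=
  4%:R *: (a ^+ 2 * c^`()) - 2%:R *: (a * b * b^`()) + a^`() * b ^+ 2.

(* The edge (e, r) if v = true, and (r, e) if v = false. *)
Definition edge (R : realType) (v e : bool) (r : R) : R * R :=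
  if v then (e%:R, r) else (r, e%:R).

Definition corners (R : realType) : set (R * R) :=
  [set p | exists e1 e2 : bool, p = (e1%:R, e2%:R)].
Arguments corners : clear implicits.

Definition edge_candidates (R : realType) (f : R * R -> R) (v e : bool) :
    set (R * R) :=
  [set p | exists d2 d1 d0 : R,
     [/\ forall r : R, 0 <= r <= 1 ->
           f (edge v e r) = d2 * r ^+ 2 + d1 * r + d0,
         0 < d2,
         0 < - d1 / (2%:R * d2) < 1
       & p = edge v e (- d1 / (2%:R * d2))]].

Definition perimeter_candidates (R : realType) (f : R * R -> R) :
    set (R * R) :=
  corners R `|` [set p | exists v e : bool, edge_candidates f v e p].

Definition interior_candidates (R : realType) (f : R * R -> R) :
    set (R * R) :=
  [set p | exists a b c : {poly R}, face_coeffs f a b c /\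
     Ppoly a b c != 0 /\
     exists t : R,
       [/\ 0 < t < 1, root (Ppoly a b c) t, 0 < a.[t],
           0 < - b.[t] / (2%:R * a.[t]) < 1
         & p = (- b.[t] / (2%:R * a.[t]), t)]].

Definition candidates (R : realType) (f : R * R -> R) : set (R * R) :=
  perimeter_candidates f `|` interior_candidates f.

Definition all_face_candidates (R : realType) (F : 'rV[R]_3 -> 'rV[R]_3) :
    set 'rV[R]_3 :=
  [set q | exists phi : face, (face_point phi @` candidates (face_fun F phi)) q].

Definition is_min (R : realType) (A : set R) (m : R) : Prop :=
  A m /\ lbound A m.

(* Main.v *)
Require Import Defs.
From HB Require Import structures.
From mathcomp Require Import all_boot all_order all_algebra.
From mathcomp Require Import all_classical all_reals all_analysis.
From mathcomp Require Import ring lra.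

Import Order.TTheory GRing.Theory Num.Theory.
Import numFieldNormedType.Exports.

Local Open Scope classical_set_scope.
Local Open Scope ring_scope.

(** The Jacobian of a trilinear map, restricted to a face, is a quadratic
    [a s^2 + b s + c] in [s].  A minimizer inside the face is stationary.  If
    [a t = 0] there, then also [b t = 0], so [f] is constant along the segment
    through the point and the minimum is attained on an edge.  If [a t > 0],
    then [s = - b / (2 a)] and the derivative in [t], multiplied by [4 a^2],
    becomes [P t = 0].  If [P] vanishes identically, the critical value
    [c - b^2 / (4 a)] is constant along the curve of critical points; this is
    excluded by choosing a minimizer with the largest [t]. *)

(** * Quadratics in one variable on the unit interval *)

Lemma quadratic_coef_uniq (R : realFieldType) (a b c a' b' c' : R) :
  (forall s, 0 <= s <= 1 ->
     a * s ^+ 2 + b * s + c = a' * s ^+ 2 + b' * s + c') ->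
  [/\ a = a', b = b' & c = c'].
Proof.
move=> h.
have h0 : a * 0 ^+ 2 + b * 0 + c = a' * 0 ^+ 2 + b' * 0 + c'.
  by apply: h; apply/andP; split; lra.
have h1 : a * 1 ^+ 2 + b * 1 + c = a' * 1 ^+ 2 + b' * 1 + c'.
  by apply: h; apply/andP; split; lra.
have h2 : a * (1 / 2%:R) ^+ 2 + b * (1 / 2%:R) + c =
          a' * (1 / 2%:R) ^+ 2 + b' * (1 / 2%:R) + c'.
  by apply: h; apply/andP; split; lra.
by split; lra.
Qed.

(** The first and second order conditions come from finite increments alone: two opposite increments
    force [a] to be nonnegative, and a small increment against the sign of the slope rules out a
    nonzero slope. *)
Lemma quadratic_min_interior (R : realFieldType) (a b c r : R) : 0 < r < 1 ->
  (forall u, 0 <= u <= 1 ->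
     a * r ^+ 2 + b * r + c <= a * u ^+ 2 + b * u + c) ->
  2%:R * a * r + b = 0 /\ 0 <= a.
Proof.
move=> /andP[r0 r1] hmin; set g := 2%:R * a * r + b.
(* The distance from [r] to the nearer endpoint: increments of size at most [d] stay in the
   interval. *)
pose d := Num.min r (1 - r).
have d0 : 0 < d by rewrite lt_min r0; lra.
have dr : d <= r by rewrite ge_min lexx.
have dr' : d <= 1 - r by rewrite ge_min lexx orbT.
have step h : - d <= h <= d -> 0 <= g * h + a * h ^+ 2.
  move=> /andP[h1 h2].
  have : 0 <= r + h <= 1 by apply/andP; split; lra.
  by move=> /hmin; rewrite /g; lra.
have a0 : 0 <= a.
  have h1 : 0 <= g * d + a * d ^+ 2 by apply: step; apply/andP; split; lra.
  have h2 : 0 <= g * (- d) + a * (- d) ^+ 2.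
    by apply: step; apply/andP; split; lra.
  have d2 : 0 < d ^+ 2 by rewrite exprn_gt0.
  by rewrite -(pmulr_rge0 _ d2); lra.
split=> //; case: (eqVneq g 0) => // gn0; exfalso.
(* The increment - g e with small e > 0 strictly decreases the quadratic. *)
have ng0 : 0 < `|g| by rewrite normr_gt0.
have ad : 0 <= a * d by rewrite mulr_ge0// ltW.
(* This denominator secures two bounds at once: the increment has size at most [d], and [a * e] is
   at most 1/2, so the change [e * g ^+ 2 * (a * e - 1)] is negative. *)
pose e := d / (`|g| + 2%:R * (a * d)).
have D0 : 0 < `|g| + 2%:R * (a * d) by lra.
have e0 : 0 < e by rewrite divr_gt0.
have eE : e * `|g| + 2%:R * e * (a * d) = d.
  by rewrite /e; field; rewrite gt_eqF.
have ead : 0 <= e * (a * d) by rewrite mulr_ge0// ltW.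
have hge : - d <= - (g * e) <= d.
  rewrite -ler_norml normrN normrM (gtr0_norm e0) mulrC; lra.
have := step _ hge.
have -> : g * - (g * e) + a * (- (g * e)) ^+ 2 = e * g ^+ 2 * (a * e - 1).
  by ring.
have eg2 : 0 < e * g ^+ 2 by rewrite mulr_gt0// exprn_even_gt0.
rewrite (pmulr_rge0 _ eg2) subr_ge0 => ae.
have : d <= a * e * d by rewrite ler_peMl// ltW.
have : 0 < e * `|g| by rewrite mulr_gt0.
lra.
Qed.

(** * Polynomials of small degree and their roots *)

Section PolySmall.
Variable R : realFieldType.
Implicit Types a b c : {poly R}.

Lemma horner_size2 a : (size a <= 2)%N -> forall t, a.[t] = a`_0 + a`_1 * t.
Proof.
by move=> sa t; rewrite (horner_coef_wide _ sa) !big_ord_recl big_ord0 /=; ring.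
Qed.

Lemma horner_size3 b : (size b <= 3)%N ->
  forall t, b.[t] = b`_0 + b`_1 * t + b`_2 * t ^+ 2.
Proof.
by move=> sb t; rewrite (horner_coef_wide _ sb) !big_ord_recl big_ord0 /=; ring.
Qed.

Lemma horner_deriv_size3 b : (size b <= 3)%N ->
  forall t, (b^`()).[t] = b`_1 + 2%:R * b`_2 * t.
Proof.
move=> sb t; have sb' : (size b^`() <= 2)%N.
  by rewrite (leq_trans (size_poly _ _))//; case: size sb.
rewrite (horner_coef_wide _ sb') !big_ord_recl big_ord0 /= !coef_deriv /bump /=.
by ring.
Qed.

Lemma poly_size3_eq b c : (size b <= 3)%N -> (size c <= 3)%N ->
  (forall t, 0 <= t <= 1 -> b.[t] = c.[t]) -> b = c.
Proof.
move=> sb sc h.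
have [h2 h1 h0] : [/\ b`_2 = c`_2, b`_1 = c`_1 & b`_0 = c`_0].
  apply: quadratic_coef_uniq => s s01.
  have := h s s01; rewrite (horner_size3 _ sb) (horner_size3 _ sc); lra.
apply/polyP => -[|[|[|i]]] //.
by rewrite !nth_default// ?(leq_trans sb) ?(leq_trans sc).
Qed.

(** The factor theorem removes one root at a time, each lowering the size by one. A list is enough
    for the upper bound on interior candidates. *)
Lemma root_seq (p : {poly R}) : p != 0 ->
  exists2 s : seq R, (size s < size p)%N & forall t, root p t -> t \in s.
Proof.
have [n] := ubnP (size p); elim: n p => // n IH p sp p0.
have [[r pr]|nr] := pselect (exists r, root p r); last first.
  exists [::]; first by rewrite size_poly_gt0.
  by move=> t pt; exfalso; apply: nr; exists t.
have [q pE] := factor_theorem p r pr.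
have q0 : q != 0 by apply: contraNneq p0 => q0; rewrite pE q0 mul0r.
have spq : size p = (size q).+1.
  by rewrite pE size_Mmonic ?monicXsubC// size_XsubC addn2.
have [|s sq hs] := IH q _ q0; first by rewrite -ltnS -spq.
exists (r :: s); first by rewrite /= spq ltnS.
move=> t; rewrite pE rootM root_XsubC inE => /orP[/hs ->|->]//.
by rewrite orbT.
Qed.

End PolySmall.

(** * The polynomial P: its degree, and the case where it vanishes *)

Section PpolyTheory.
Variable R : realType.
Implicit Types a b c : {poly R}.

(** The three terms of P have degree at most 3, 4 and 4. *)
Lemma size_Ppoly a b c : (size a <= 2)%N -> (size b <= 3)%N ->
  (size c <= 3)%N -> (size (Ppoly a b c) <= 5)%N.
Proof.
move=> sa sb sc.
have sd (p : {poly R}) n : (size p <= n.+1)%N -> (size p^`() <= n)%N.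
  move=> sp; rewrite (leq_trans (size_poly _ _))//.
  by case: size sp.
(* Size is degree plus one, so [m] and [n] are degree bounds, which add under multiplication. *)
have sM (p q : {poly R}) m n : (size p <= m.+1)%N -> (size q <= n.+1)%N ->
    (size (p * q)%R <= (m + n).+1)%N.
  move=> sp sq; rewrite (leq_trans (size_polyMleq _ _))//.
  have := leq_add sp sq; rewrite addSn addnS.
  by case: (size p + size q)%N.
rewrite /Ppoly (leq_trans (size_polyD _ _))// geq_max.
rewrite (leq_trans (size_polyD _ _)) ?geq_max ?size_polyN.
- have : (size (a^`() * b ^+ 2)%R <= 5)%N.
    by rewrite expr2; apply: (@sM _ _ 0 4); [exact: sd|exact: (@sM _ _ 2 2)].
  by move=> ->.
rewrite !(leq_trans (size_scale_leq _ _))//.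
  by rewrite (leq_trans (@sM _ _ 3 1 _ _))//; [exact: (@sM _ _ 1 2)|exact: sd].
rewrite (leq_trans (@sM _ _ 2 1 _ _))//; last exact: sd.
by rewrite expr2; exact: (@sM _ _ 1 1).
Qed.

Lemma horner_Ppoly a b c t :
  (Ppoly a b c).[t] = 4%:R * (a.[t] ^+ 2 * c^`().[t])
    - 2%:R * (a.[t] * b.[t] * b^`().[t]) + a^`().[t] * b.[t] ^+ 2.
Proof. by rewrite /Ppoly !hornerE. Qed.

(* P is a D' - a' D for D = 4 a c - b^2.  When it vanishes, differentiating
   gives a D'' = 0 because a'' = 0; hence D is affine and proportional to a. *)
Lemma Ppoly_eq0_proportional a b c t u : (size a <= 2)%N -> a != 0 ->
  Ppoly a b c = 0 ->
  (4%:R * a.[t] * c.[t] - b.[t] ^+ 2) * a.[u] =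
  (4%:R * a.[u] * c.[u] - b.[u] ^+ 2) * a.[t].
Proof.
move=> sa a0 P0; pose D := 4%:R *: (a * c) - b ^+ 2.
have DE v : D.[v] = 4%:R * a.[v] * c.[v] - b.[v] ^+ 2.
  by rewrite /D !hornerE.
rewrite -!DE.
have PE : a * D^`() = a^`() * D.
  apply/eqP; rewrite -subr_eq0 -P0 /D /Ppoly !scaler_nat !expr2.
  rewrite !(derivB, derivM, derivMn); apply/eqP.
  ring.
have a2 : a^`()^`() = 0.
  apply/eqP; rewrite -size_poly_leq0.
  rewrite (leq_trans (size_poly _ _))// -subn1 leq_subLR.
  by rewrite (leq_trans (size_poly _ _))//; case: size sa.
have D2 : D^`()^`() = 0.
  have := congr1 (fun p : {poly R} => p^`()) PE.
  rewrite !derivM a2 mul0r add0r => /eqP; rewrite -subr_eq0 addrAC subrr add0r.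
  by rewrite mulf_eq0 (negbTE a0) => /eqP.
have sD : (size D <= 2)%N.
  apply/leq_sizeP => -[|[|j]] // _.
  have := congr1 (fun p : {poly R} => p`_j) D2.
  rewrite !coef_deriv coef0 => /eqP.
  by rewrite -mulrnA mulrn_eq0 /= => /eqP.
(* Both [a] and [D] are now affine, and the constant coefficient of [PE] says that their coefficient
   pairs are proportional. *)
have := congr1 (fun p : {poly R} => p`_0) PE.
rewrite !coefM !big_ord_recl !big_ord0 /= !coef_deriv !addr0 !mulr1n => E.
rewrite !(horner_size2 _ _ sa) !(horner_size2 _ _ sD).
have F : a`_1 * D`_0 = a`_0 * D`_1 by [].
apply/eqP; rewrite -subr_eq0; apply/eqP.
transitivity ((a`_1 * D`_0 - a`_0 * D`_1) * (u - t)); first by ring.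
by rewrite F subrr mul0r.
Qed.
End PpolyTheory.

(** * Minimization of a quadratic family over the unit square *)

Section FaceMinimum.
Variable R : realType.
Implicit Types (a b c : {poly R}) (f : R * R -> R).

Lemma natr_bool_itv (e : bool) : 0 <= (e%:R : R) <= 1.
Proof. by case: e; rewrite ?lexx ler01. Qed.

Lemma compact_unit_square : compact (unit_square R).
Proof.
have -> : unit_square R = `[0, 1]%classic `*` `[0, 1]%classic.
  by apply/seteqP; split=> p /=; rewrite !in_itv.
by apply: compact_setX; exact: segment_compact.
Qed.

Lemma continuous_quadratic_family a b c :
  continuous (fun p : R * R => a.[p.2] * p.1 ^+ 2 + b.[p.2] * p.1 + c.[p.2]).
Proof.
move=> p.
have h2 (q : {poly R}) : (fun p : R * R => q.[p.2]) x @[x --> p] --> q.[p.2].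
  by apply: (@continuous_comp _ _ _ snd (horner q));
    [exact: cvg_snd|exact: continuous_horner].
have h1 : (fun p : R * R => p.1) x @[x --> p] --> p.1 by exact: cvg_fst.
apply: cvgD; last exact: h2.
apply: cvgD; apply: cvgM => //; try exact: h2.
by rewrite expr2; under eq_fun do rewrite expr2; exact: cvgM.
Qed.

(** Compactness is used twice: the minimizers form a compact set, on which the second coordinate
    attains its maximum. *)
Lemma lexicographic_min (g : R * R -> R) : continuous g ->
  exists2 p, unit_square R p &
    forall q, unit_square R q -> g p <= g q /\ (g q = g p -> q.2 <= p.2).
Proof.
move=> cg.
have K0 : unit_square R !=set0 by exists (0, 0); split; rewrite /= lexx ler01.
have [p0 + pmin] := compact_EVT_min K0 compact_unit_square
  (continuous_subspaceT cg).
rewrite inE => Kp0.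
pose M := unit_square R `&` g @^-1` [set g p0].
have cM : compact M.
  apply: compact_closedI; first exact: compact_unit_square.
  by apply: preimage_closed => [q _|]; [exact: cg|exact: closed_eq].
have M0 : M !=set0 by exists p0.
have [|p + pmax] := @compact_EVT_max _ _ snd _ M0 cM.
  by apply: continuous_subspaceT => q; exact: cvg_snd.
rewrite inE => -[Kp gp]; exists p => // q Kq; split.
  by rewrite gp; apply: pmin; rewrite inE.
by move=> gq; apply: pmax; rewrite inE; split => //=; rewrite gq.
Qed.

Lemma edge_quadratic f a b c v e : face_coeffs f a b c ->
  exists d2 d1 d0 : R, forall r : R, 0 <= r <= 1 ->
    f (edge v e r) = d2 * r ^+ 2 + d1 * r + d0.
Proof.
move=> [sa sb sc fE].
have e01 := natr_bool_itv e.
case: v.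
- exists (b`_2 * e%:R + c`_2), (a`_1 * e%:R ^+ 2 + b`_1 * e%:R + c`_1),
    (a`_0 * e%:R ^+ 2 + b`_0 * e%:R + c`_0) => r r01.
  rewrite /= fE// (horner_size2 _ _ sa) (horner_size3 _ _ sb).
  by rewrite (horner_size3 _ _ sc); ring.
- by exists a.[e%:R], b.[e%:R], c.[e%:R] => r r01; rewrite /= fE.
Qed.

Lemma edge_in_unit_square v e (r : R) : 0 <= r <= 1 ->
  unit_square R (edge v e r).
Proof.
have e01 := natr_bool_itv e.
by case: v.
Qed.

Lemma corners_edge v e1 (e2 : bool) : corners R (edge v e1 (e2%:R : R)).
Proof. by case: v; [exists e1, e2|exists e2, e1]. Qed.

(** A minimizer at an end of an edge is a corner. Inside the edge, a positive leading coefficient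
    makes it the vertex of the parabola; a zero one makes [f] constant on the edge, and a corner
    takes its place. *)
Lemma perimeter_min f a b c v e (r : R) : face_coeffs f a b c -> 0 <= r <= 1 ->
  (forall q, unit_square R q -> f (edge v e r) <= f q) ->
  exists2 p, perimeter_candidates f p & f p = f (edge v e r).
Proof.
move=> fc r01 rmin; have [d2 [d1 [d0 dE]]] := edge_quadratic _ _ _ _ v e fc.
have [/andP[r0 r1]|] := boolP (0 < r < 1); last first.
  rewrite negb_and -!leNgt => r_end; exists (edge v e r) => //; left.
  have [E|E] : r = false%:R \/ r = true%:R.
    by case/orP: r_end => r_end; [left|right]; case/andP: r01 => /= *; lra.
  - by rewrite E; exact: corners_edge.
  - by rewrite E; exact: corners_edge.
have r01' : 0 < r < 1 by rewrite r0.
have [|dr d2_ge0] := @quadratic_min_interior _ d2 d1 d0 r r01'.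
  move=> u u01; rewrite -!dE//; apply: rmin; exact: edge_in_unit_square.
move: d2_ge0; rewrite le_eqVlt => /orP[/eqP d20|d2_gt0].
  have z01 := natr_bool_itv false.
  exists (edge v e false%:R); first by left; exact: corners_edge.
  have d10 : d1 = 0 by move: dr; rewrite -d20; lra.
  by rewrite !dE// -d20 d10; ring.
have rE : r = - d1 / (2%:R * d2).
  have -> : d1 = - (2%:R * d2 * r) by lra.
  by field; rewrite gt_eqF.
exists (edge v e r) => //; right; exists v, e, d2, d1, d0.
by split => //; rewrite -rE.
Qed.

(** Both slices of [f] through the point are quadratics in one variable, so [quadratic_min_interior]
    applies in each direction without any differentiation of [f]. *)
Lemma interior_min_stationary f a b c (s t : R) : face_coeffs f a b c ->
  0 < s < 1 -> 0 < t < 1 ->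
  (forall q, unit_square R q -> f (s, t) <= f q) ->
  [/\ 2%:R * a.[t] * s + b.[t] = 0, 0 <= a.[t] &
      a^`().[t] * s ^+ 2 + b^`().[t] * s + c^`().[t] = 0].
Proof.
move=> [sa sb sc fE] s01 t01 stmin.
have s01' : 0 <= s <= 1 by case/andP: s01 => *; rewrite !ltW.
have t01' : 0 <= t <= 1 by case/andP: t01 => *; rewrite !ltW.
have [|ds a_ge0] := @quadratic_min_interior _ a.[t] b.[t] c.[t] s s01.
  by move=> u u01; rewrite -!fE//; exact: stmin.
split=> //.
(* The same expression regrouped by powers of [t], with [s] fixed. *)
have [|dt _] := @quadratic_min_interior _ (b`_2 * s + c`_2)
    (a`_1 * s ^+ 2 + b`_1 * s + c`_1) (a`_0 * s ^+ 2 + b`_0 * s + c`_0) t t01.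
  move=> u u01; have := stmin (s, u) (conj s01' u01).
  rewrite !fE// !(horner_size2 _ _ sa) !(horner_size3 _ _ sb).
  by rewrite !(horner_size3 _ _ sc); lra.
rewrite -[RHS]dt (horner_deriv_size3 _ a) ?(leq_trans sa)//.
rewrite !horner_deriv_size3//.
by rewrite (nth_default 0 sa); ring.
Qed.

(** Substituting [b = - 2 a s] turns P into [4 a^2] times the derivative in [t]. *)
Lemma Ppoly_stationary a b c (s t : R) : 0 < a.[t] ->
  2%:R * a.[t] * s + b.[t] = 0 ->
  a^`().[t] * s ^+ 2 + b^`().[t] * s + c^`().[t] = 0 -> root (Ppoly a b c) t.
Proof.
move=> a0 ds dt; rewrite /root horner_Ppoly.
have -> : b.[t] = - (2%:R * a.[t] * s) by lra.
apply/eqP; rewrite -[RHS](mulr0 (4%:R * a.[t] ^+ 2)) -dt; ring.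
Qed.

(* When P vanishes identically the critical value c - b^2 / (4 a) does not
   depend on t, so the minimum persists along the curve s = - b / (2 a) for
   slightly larger t. *)
Lemma Ppoly_eq0_min_extends a b c (s t : R) :
  (size a <= 2)%N -> Ppoly a b c = 0 -> 0 < s < 1 -> 0 < t < 1 ->
  0 < a.[t] -> 2%:R * a.[t] * s + b.[t] = 0 ->
  exists s' t', [/\ 0 < s' < 1, t < t' < 1 &
    a.[t'] * s' ^+ 2 + b.[t'] * s' + c.[t'] =
    a.[t] * s ^+ 2 + b.[t] * s + c.[t]].
Proof.
move=> sa P0 /andP[s0 s1] /andP[t0 t1] at0 ds.
have a0 : a != 0 by apply: contraTneq at0 => ->; rewrite horner0 ltxx.
have pos (q : {poly R}) : 0 < q.[t] -> \forall x \near t^'+, 0 < q.[x].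
  move=> qt; apply: (cvgr_gt q.[t]) => //.
  by apply: cvg_at_right_filter; exact: continuous_horner.
have as0 : 0 < a.[t] * s by rewrite mulr_gt0.
have as1 : 0 < a.[t] * (1 - s) by rewrite mulr_gt0// subr_gt0.
(* The last three conditions say that [- b / (2 a)] lies strictly between 0 and 1. They are open and
   hold at [t], hence persist just to its right. *)
have near_t : \forall x \near t^'+, [/\ t < x < 1, 0 < a.[x],
    0 < (- b).[x] & 0 < (2%:R *: a + b).[x]].
  have b1 : 0 < (- b).[t] by rewrite hornerE; lra.
  have b2 : 0 < (2%:R *: a + b).[t] by rewrite !hornerE; lra.
  near=> x; split; [apply/andP; split|..]; near: x.
  - exact: nbhs_right_gt.
  - exact: nbhs_right_lt.
  - exact: pos.
  - exact: pos.
  - exact: pos.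
have [x [tx ax bx1 bx2]] := filter_ex near_t.
rewrite !hornerE in bx1 bx2.
exists (- b.[x] / (2%:R * a.[x])), x; split => //.
  by rewrite divr_gt0 ?mulr_gt0//= ltr_pdivrMr ?mulr_gt0// mul1r; lra.
have := Ppoly_eq0_proportional _ a b c x t sa a0 P0.
have -> : b.[t] = - (2%:R * a.[t] * s) by lra.
move=> E; apply: (mulfI (x := 4%:R * a.[x] * a.[t])).
  by rewrite !mulf_neq0 ?gt_eqF.
transitivity ((4%:R * a.[x] * c.[x] - b.[x] ^+ 2) * a.[t]).
  by field; rewrite gt_eqF.
by rewrite E; ring.
Unshelve. all: by end_near. Qed.

Lemma candidate_min f a b c : face_coeffs f a b c ->
  exists2 p, candidates f p & forall q, unit_square R q -> f p <= f q.
Proof.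
move=> fc; have [sa sb sc fE] := fc.
have [[s t] [/= s01 t01] stlex] :=
  lexicographic_min _ (continuous_quadratic_family a b c).
have stmin q : unit_square R q -> f (s, t) <= f q.
  case: q => x y [/= x01 y01]; rewrite !fE//.
  by have [] := stlex (x, y) (conj x01 y01).
have perim v e r : 0 <= r <= 1 -> f (edge v e r) = f (s, t) ->
    exists2 p, candidates f p & forall q, unit_square R q -> f p <= f q.
  move=> r01 fr; have [|p cp pr] := perimeter_min _ _ _ _ v e r fc r01.
    by move=> q; rewrite fr; exact: stmin.
  by exists p; [left|move=> q; rewrite pr fr; exact: stmin].
have ends (x : R) : 0 <= x <= 1 -> 0 < x < 1 \/ exists e : bool, x = e%:R.
  move=> /andP[x0 x1]; have [|] := boolP (0 < x < 1); first by left.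
  rewrite negb_and -!leNgt => /orP[] h; right; [exists false|exists true] => /=.
    by lra.
  by lra.
have [s01'|[e sE]] := ends s s01; last first.
  by apply: (perim true e t) => //; rewrite sE.
have [t01'|[e tE]] := ends t t01; last first.
  by apply: (perim false e s) => //; rewrite tE.
have [ds a_ge0 dt] := interior_min_stationary _ _ _ _ _ _ fc s01' t01' stmin.
move: a_ge0; rewrite le_eqVlt => /orP[/eqP at0|at0].
  apply: (perim true false t) => //.
  have bt0 : b.[t] = 0 by move: ds; rewrite -at0; lra.
  by rewrite /= !fE ?lexx ?ler01// -at0 bt0; ring.
have [P0|P0] := eqVneq (Ppoly a b c) 0.
  have [s' [t' [s'01 /andP[tt' t'1] E]]] :=
    Ppoly_eq0_min_extends _ _ _ _ _ sa P0 s01' t01' at0 ds.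
  (* The extended minimizer lies at a larger [t'], against the tie-breaking of
     [lexicographic_min]. *)
  have : t' <= t.
    have [|_ ] := stlex (s', t'); last by apply.
    case/andP: s'01 => ? ?; case/andP: t01 => ? _.
    by split; rewrite /= !ltW//=; lra.
  by rewrite leNgt tt'.
exists (s, t) => //; right; exists a, b, c; split=> //; split=> //.
have sE : - b.[t] / (2%:R * a.[t]) = s.
  have -> : b.[t] = - (2%:R * a.[t] * s) by lra.
  by field; rewrite gt_eqF.
exists t; rewrite sE; split=> //; exact: Ppoly_stationary ds dt.
Qed.

End FaceMinimum.

(** * Number of candidates *)

(** The map [nth] sends the indices onto the entries of the list; repeated entries are harmless for
    an upper bound. *)
Lemma card_le_size (T : eqType) (A : set T) (s : seq T) :
  (forall x, A x -> x \in s) -> (A #<= `I_(size s))%card.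
Proof.
(* The head serves as the default value of [nth], so the empty list is settled apart. *)
case: s => [|x0 s] sA.
  have -> : A = set0 by apply/seteqP; split=> x // /sA.
  exact: card_ge0.
set S := x0 :: s.
have AS : A `<=` nth x0 S @` `I_(size S).
  move=> x /sA xs; exists (index x S); last by rewrite nth_index.
  by rewrite /mkset index_mem.
exact: card_le_trans (subset_card_le AS) (card_image_le _ _).
Qed.

Section CandidateCount.
Variable R : realType.
Implicit Types (a b c : {poly R}) (f : R * R -> R).

(** For fixed [t] the quadratics in [s] agree, and then the coefficient polynomials agree on the
    unit interval. This pins down the coefficients quantified existentially in
    [interior_candidates]. *)
Lemma face_coeffs_uniq f a b c a' b' c' : face_coeffs f a b c ->
  face_coeffs f a' b' c' -> [/\ a = a', b = b' & c = c'].
Proof.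
move=> [sa sb sc fE] [sa' sb' sc' fE'].
have E (t : R) : 0 <= t <= 1 ->
    [/\ a.[t] = a'.[t], b.[t] = b'.[t] & c.[t] = c'.[t]].
  move=> t01; apply: quadratic_coef_uniq => s s01.
  by rewrite -fE// -fE'.
by split; apply: poly_size3_eq; rewrite ?(leq_trans sa) ?(leq_trans sa')//;
  move=> t /E [].
Qed.

(** The coefficients of a quadratic are determined by its values on the edge, hence so is its
    vertex. *)
Lemma edge_candidate_uniq f a b c v e : face_coeffs f a b c ->
  exists x, forall p, edge_candidates f v e p -> p = x.
Proof.
move=> fc; have [d2 [d1 [d0 dE]]] := edge_quadratic _ _ _ _ _ v e fc.
exists (edge v e (- d1 / (2%:R * d2))) => p [d2' [d1' [d0' [dE' _ _ ->]]]].
have [-> -> _] // : [/\ d2 = d2', d1 = d1' & d0 = d0'].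
by apply: quadratic_coef_uniq => s s01; rewrite -dE// -dE'.
Qed.

Lemma card_perimeter_candidates f a b c : face_coeffs f a b c ->
  (perimeter_candidates f #<= `I_8)%card.
Proof.
move=> fc.
have [x00 h00] := edge_candidate_uniq _ _ _ _ false false fc.
have [x01 h01] := edge_candidate_uniq _ _ _ _ false true fc.
have [x10 h10] := edge_candidate_uniq _ _ _ _ true false fc.
have [x11 h11] := edge_candidate_uniq _ _ _ _ true true fc.
apply: (@card_le_size _ _ [:: (0, 0); (0, 1); (1, 0); (1, 1);
  x00; x01; x10; x11]) => p.
move=> [[e1 [e2 ->]]|[[] [[] /= h]]].
- by case: e1; case: e2; rewrite !inE eqxx ?orbT.
- by rewrite (h11 _ h) !inE eqxx !orbT.
- by rewrite (h10 _ h) !inE eqxx !orbT.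
- by rewrite (h01 _ h) !inE eqxx !orbT.
- by rewrite (h00 _ h) !inE eqxx !orbT.
Qed.

(** Each interior candidate is determined by its [t], which is one of at most four roots of P. *)
Lemma card_interior_candidates f a b c : face_coeffs f a b c ->
  (interior_candidates f #<= `I_4)%card.
Proof.
move=> fc; have [P0|P0] := eqVneq (Ppoly a b c) 0.
  have -> : interior_candidates f = set0; last exact: card_ge0.
  apply/seteqP; split=> // p [a' [b' [c' [fc' [+ _]]]]].
  by have [<- <- <-] := face_coeffs_uniq _ _ _ _ _ _ _ fc fc'; rewrite P0 eqxx.
have [s ss rs] := root_seq _ _ P0.
pose S := [seq (- b.[t] / (2%:R * a.[t]), t) | t <- s].
have S4 : (size S <= 4)%N.
  rewrite size_map -ltnS (leq_trans ss)//.
  by case: fc => *; exact: size_Ppoly.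
apply: (@card_le_trans _ _ _ `I_(size S)); last by rewrite card_le_II.
apply: card_le_size => p [a' [b' [c' [fc' [_ [t [_ + _ _ ->]]]]]]].
have [<- <- <-] := face_coeffs_uniq _ _ _ _ _ _ _ fc fc'.
by move=> /rs ts; apply/mapP; exists t.
Qed.

Lemma finite_candidates f a b c : face_coeffs f a b c ->
  finite_set (candidates f).
Proof.
move=> fc; rewrite finite_setU; split.
- exact: card_le_finite (card_perimeter_candidates _ _ _ _ fc) (finite_II 8).
- exact: card_le_finite (card_interior_candidates _ _ _ _ fc) (finite_II 4).
Qed.

Lemma candidates_sub_unit_square f : candidates f `<=` unit_square R.
Proof.
have itvW (x : R) : 0 < x < 1 -> 0 <= x <= 1 by case/andP => *; rewrite !ltW.
move=> p [[[e1 [e2 ->]]|[v [e [d2 [d1 [d0 [_ _ r01 ->]]]]]]]|].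
- by split; exact: natr_bool_itv.
- by apply: edge_in_unit_square; exact: itvW.
by move=> [a [b [c [_ [_ [t [t01 _ _ s01 ->]]]]]]]; split; exact: itvW.
Qed.

End CandidateCount.

(** * Jacobian of a trilinear map *)

Section TrilinearJacobian.
Variables (R : realType) (F : 'rV[R]_3 -> 'rV[R]_3).
Hypothesis hF : trilinear F.
Implicit Types (p : 'rV[R]_3) (x y z : R).

Lemma set_coord_id p i : set_coord p i (p 0 i) = p.
Proof. by apply/rowP => j; rewrite mxE; case: eqP => [->|]. Qed.

Lemma addr_delta_mx p i (h : R) :
  p + h *: delta_mx 0 i = set_coord p i (p 0 i + h).
Proof.
apply/rowP => j; rewrite !mxE eqxx /=; case: eqP => [->|_].
  by rewrite mulr1.
by rewrite mulr0 addr0.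
Qed.

Lemma cube_set_coord p i (u : R) : cube p ->
  cube (set_coord p i u) <-> 0 <= u <= 1.
Proof.
move=> cp; split=> [/(_ i)|u01 j]; rewrite mxE ?eqxx//.
by case: ifP.
Qed.

(** Properness makes the limit in [partial] unique, also at boundary points where only one-sided
    increments are allowed. *)
Lemma admissible_increments_proper p i : cube p ->
  ProperFilter (within [set h : R | cube (p + h *: delta_mx 0 i)] 0^').
Proof.
move=> cp; apply: Build_ProperFilter_ex => P.
rewrite /within/= => /nbhs_ballP[e /= e0 eP].
have /andP[p0 p1] := cp i.
(* A step of at most 1/2 towards the farther end of the unit interval stays inside it. *)
pose d := Num.min (e / 2%:R) (1 / 2%:R).
have d0 : 0 < d by rewrite lt_min; apply/andP; split; lra.
have de : d < e by rewrite gt_min; apply/orP; left; lra.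
have dh : d <= 1 / 2%:R by rewrite ge_min lexx orbT.
have [ph|ph] := leP (p 0 i) (1 / 2%:R).
- exists d; apply: eP; rewrite /= ?gt_eqF//.
    by rewrite /ball /= sub0r normrN gtr0_norm.
  by rewrite addr_delta_mx cube_set_coord//; apply/andP; split; lra.
- exists (- d); apply: eP; rewrite /= ?oppr_eq0 ?gt_eqF//.
    by rewrite /ball /= sub0r opprK gtr0_norm.
  by rewrite addr_delta_mx cube_set_coord//; apply/andP; split; lra.
Qed.

(** Along a coordinate line [F] is affine, so the difference quotient is constant over all
    admissible nonzero increments. *)
Lemma partial_trilinear p i : cube p ->
  partial F i p = F (set_coord p i 1) - F (set_coord p i 0).
Proof.
move=> cp; have [A [B AB]] := hF p i cp.
have PF := admissible_increments_proper p i cp.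
rewrite !AB ?lexx ?ler01// scale1r scale0r addr0 addrAC subrr add0r.
apply: cvg_lim; first exact: norm_hausdorff.
apply: cvg_near_cst; rewrite near_withinE; near=> h => ch.
have h0 : h != 0 by near: h; exact: nbhs_dnbhs_neq.
have {}ch : 0 <= p 0 i + h <= 1.
  by move: ch => /=; rewrite addr_delta_mx cube_set_coord.
rewrite addr_delta_mx AB// -{2}(set_coord_id p i) AB//.
rewrite opprD addrACA subrr add0r -scalerBl addrAC subrr add0r.
by rewrite scalerA mulVf// scale1r.
Unshelve. all: by end_near. Qed.

Lemma trilinear_coord p i (u : R) : cube p -> 0 <= u <= 1 ->
  F (set_coord p i u) = F (set_coord p i 0) +
    u *: (F (set_coord p i 1) - F (set_coord p i 0)).
Proof.
move=> cp u01; have [A [B AB]] := hF p i cp.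
by rewrite !AB ?lexx ?ler01// scale1r scale0r addr0 addrAC subrr add0r.
Qed.

Lemma cube_point3 x y z : 0 <= x <= 1 -> 0 <= y <= 1 -> 0 <= z <= 1 ->
  cube (point3 x y z).
Proof. by move=> hx hy hz [[|[|[|//]]] ?]; rewrite mxE. Qed.

Lemma set_coord_point3 x y z u :
  [/\ set_coord (point3 x y z) 0 u = point3 u y z,
      set_coord (point3 x y z) 1 u = point3 x u z &
      set_coord (point3 x y z) 2%:R u = point3 x y u].
Proof. by split; apply/rowP => -[[|[|[|//]]] ?]; rewrite !mxE. Qed.

End TrilinearJacobian.

(** * Three by three determinants as functions of their columns *)

Section Det3.
Variable R : comNzRingType.

(** The row vectors are placed as columns, to match [DF]. *)
Definition det3 (u v w : 'rV[R]_3) : R :=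
  \det (\matrix_(i < 3, j < 3) [:: u; v; w]`_j 0 i).

End Det3.
Arguments det3 {R} u v w.

Section Det3Theory.
Variable R : comNzRingType.
Implicit Types u v w : 'rV[R]_3.

Lemma det3E u v w : det3 u v w =
   u 0 0 * (v 0 1 * w 0 2%:R - v 0 2%:R * w 0 1)
 - v 0 0 * (u 0 1 * w 0 2%:R - u 0 2%:R * w 0 1)
 + w 0 0 * (u 0 1 * v 0 2%:R - u 0 2%:R * v 0 1).
Proof.
rewrite /det3 (expand_det_row _ 0) !big_ord_recl big_ord0 addr0.
rewrite /cofactor !(expand_det_row _ 0) !big_ord_recl !big_ord0 !addr0.
rewrite /cofactor !det_mx11 !mxE /=.
have E1 : lift 0 0 = 1 :> 'I_3 by exact: val_inj.
have E2 : lift 0 1 = 2%:R :> 'I_3 by exact: val_inj.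
have E3 : lift 0 (lift 0 0) = 2%:R :> 'I_3 by exact: val_inj.
rewrite ?E1 ?E2 ?E3 /=.
ring.
Qed.
(** Like [det3_rot], this brings the derivative normal to a face into the first column; here the
    exchange of columns costs a sign. *)
Lemma det3_swap u v w : det3 u v w = det3 (- v) u w.
Proof. by rewrite !det3E !mxE; ring. Qed.

Lemma det3_rot u v w : det3 u v w = det3 w u v.
Proof. by rewrite !det3E; ring. Qed.

(* On a face the two tangential derivatives carry the same mixed coefficient q,
   so that the s^2 coefficient det (B + t D, p, q) is only affine in t. *)
Lemma det3_face (A B C D p q r : 'rV[R]_3) :
  exists a0 a1 b0 b1 b2 c0 c1 c2 : R, forall s t,
    det3 (A + s *: B + t *: C + (s * t) *: D) (p + t *: q) (r + s *: q) =
    (a0 + a1 * t) * s ^+ 2 + (b0 + b1 * t + b2 * t ^+ 2) * s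
    + (c0 + c1 * t + c2 * t ^+ 2).
Proof.
(* Multilinear expansion, sorted by monomials; the terms with [q] in both of the last two columns
   vanish. *)
exists (det3 B p q), (det3 D p q),
  (det3 B p r + det3 A p q),
  (det3 D p r + det3 C p q + det3 B q r), (det3 D q r),
  (det3 A p r), (det3 C p r + det3 A q r), (det3 C q r) => s t.
by rewrite !det3E !mxE; ring.
Qed.

End Det3Theory.

(** * The Jacobian on the six faces *)

Section Faces.
Variables (R : realType) (F : 'rV[R]_3 -> 'rV[R]_3).
Hypothesis hF : trilinear F.
Local Notation G x y z := (F (point3 x y z)).

Lemma Jac_point3 (x y z : R) : 0 <= x <= 1 -> 0 <= y <= 1 -> 0 <= z <= 1 ->
  Jac F (point3 x y z) = det3 (G 1 y z - G 0 y z) (G x 1 z - G x 0 z)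
    (G x y 1 - G x y 0).
Proof.
move=> hx hy hz; have cp := cube_point3 _ _ _ _ hx hy hz.
have [X1 Y1 Z1] := set_coord_point3 _ x y z 1.
have [X0 Y0 Z0] := set_coord_point3 _ x y z 0.
rewrite -X1 -X0 -Y1 -Y0 -Z1 -Z0 -!partial_trilinear//.
congr (\det _); apply/matrixP => i j; rewrite !mxE.
have [->|[->|->]] : j = 0 \/ j = 1 \/ j = 2%:R.
  by case: j => [[|[|[|//]]] ?];
    [left|right; left|right; right]; exact: val_inj.
- by [].
- by [].
- by [].
Qed.

Lemma trilinear_point3 (x y z : R) :
  0 <= x <= 1 -> 0 <= y <= 1 -> 0 <= z <= 1 ->
  [/\ G x y z = G 0 y z + x *: (G 1 y z - G 0 y z),
      G x y z = G x 0 z + y *: (G x 1 z - G x 0 z) &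
      G x y z = G x y 0 + z *: (G x y 1 - G x y 0)].
Proof.
move=> hx hy hz; have cp := cube_point3 _ _ _ _ hx hy hz.
have [X1 Y1 Z1] := set_coord_point3 _ x y z 1.
have [X0 Y0 Z0] := set_coord_point3 _ x y z 0.
have [Xx _ _] := set_coord_point3 _ x y z x.
have [_ Yy _] := set_coord_point3 _ x y z y.
have [_ _ Zz] := set_coord_point3 _ x y z z.
split.
- by rewrite -X1 -X0 -{1}Xx; exact: trilinear_coord.
- by rewrite -Y1 -Y0 -{1}Yy; exact: trilinear_coord.
- by rewrite -Z1 -Z0 -{1}Zz; exact: trilinear_coord.
Qed.

Definition bilinear_on_square (g : R -> R -> 'rV[R]_3) : Prop :=
  exists A B C D, forall s t, 0 <= s <= 1 -> 0 <= t <= 1 ->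
    g s t = A + s *: B + t *: C + (s * t) *: D.

Lemma bilinear_of_separately_affine (g : R -> R -> 'rV[R]_3) :
  (forall s t, 0 <= s <= 1 -> 0 <= t <= 1 ->
     g s t = g 0 t + s *: (g 1 t - g 0 t)) ->
  (forall s t, 0 <= s <= 1 -> 0 <= t <= 1 ->
     g s t = g s 0 + t *: (g s 1 - g s 0)) ->
  bilinear_on_square g.
Proof.
move=> g1 g2; exists (g 0 0), (g 1 0 - g 0 0), (g 0 1 - g 0 0),
  (g 1 1 - g 1 0 - g 0 1 + g 0 0) => s t s01 t01.
have I0 : 0 <= (0 : R) <= 1 by rewrite lexx ler01.
have I1 : 0 <= (1 : R) <= 1 by rewrite lexx ler01.
rewrite g1// (g2 0)// (g2 1)//.
by apply/rowP => i; rewrite !mxE; ring.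
Qed.

Lemma bilinear_on_squareB g h : bilinear_on_square g ->
  bilinear_on_square h -> bilinear_on_square (fun s t => g s t - h s t).
Proof.
move=> [A [B [C [D gE]]]] [A' [B' [C' [D' hE]]]].
exists (A - A'), (B - B'), (C - C'), (D - D') => s t s01 t01.
by rewrite gE// hE//; apply/rowP => i; rewrite !mxE; ring.
Qed.

(** Here [g] is the normal derivative up to sign and [k] is the map on the face. The two tangential
    differences of [k] are [B' + t D'] and [C' + s D'], with the common mixed coefficient that
    [det3_face] requires. *)
Lemma face_coeffs_det3 g k (f : R * R -> R) :
  bilinear_on_square g -> bilinear_on_square k ->
  (forall s t, 0 <= s <= 1 -> 0 <= t <= 1 ->
     f (s, t) = det3 (g s t) (k 1 t - k 0 t) (k s 1 - k s 0)) ->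
  exists a b c, face_coeffs f a b c.
Proof.
move=> [A [B [C [D gE]]]] [A' [B' [C' [D' kE]]]] fE.
have [a0 [a1 [b0 [b1 [b2 [c0 [c1 [c2 E]]]]]]]] := det3_face _ A B C D B' D' C'.
exists (Poly [:: a0; a1]), (Poly [:: b0; b1; b2]), (Poly [:: c0; c1; c2]).
split; rewrite ?(leq_trans (size_Poly _))// => s t s01 t01.
have I0 : 0 <= (0 : R) <= 1 by rewrite lexx ler01.
have I1 : 0 <= (1 : R) <= 1 by rewrite lexx ler01.
rewrite !horner_Poly /= fE// gE// !kE//.
transitivity ((a0 + a1 * t) * s ^+ 2 + (b0 + b1 * t + b2 * t ^+ 2) * s
    + (c0 + c1 * t + c2 * t ^+ 2)); last by ring.
rewrite -E; congr (det3 _ _ _).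
  by apply/rowP => i; rewrite !mxE; ring.
by apply/rowP => i; rewrite !mxE; ring.
Qed.

Lemma face_coeffs_exist phi : exists a b c, face_coeffs (face_fun F phi) a b c.
Proof.
have I0 : 0 <= (0 : R) <= 1 by rewrite lexx ler01.
have I1 : 0 <= (1 : R) <= 1 by rewrite lexx ler01.
have X x : 0 <= x <= 1 -> bilinear_on_square (fun s t => G x s t).
  by move=> x01; apply: bilinear_of_separately_affine => s t s01 t01;
    have [_ ? ?] := trilinear_point3 x s t x01 s01 t01.
have Y y : 0 <= y <= 1 -> bilinear_on_square (fun s t => G s y t).
  by move=> y01; apply: bilinear_of_separately_affine => s t s01 t01;
    have [? _ ?] := trilinear_point3 s y t s01 y01 t01.
have Z z : 0 <= z <= 1 -> bilinear_on_square (fun s t => G s t z).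
  by move=> z01; apply: bilinear_of_separately_affine => s t s01 t01;
    have [? ? _] := trilinear_point3 s t z s01 t01 z01.
case: phi => e; have e01 := natr_bool_itv R e.
- apply: (face_coeffs_det3 _ _ _ (bilinear_on_squareB _ _ (X 1 I1) (X 0 I0))
    (X _ e01)) => s t s01 t01.
  by rewrite /face_fun /= Jac_point3.
(* The normal difference is taken in reverse order, which absorbs the sign from [det3_swap]. *)
- apply: (face_coeffs_det3 _ _ _ (bilinear_on_squareB _ _ (Y 0 I0) (Y 1 I1))
    (Y _ e01)) => s t s01 t01.
  by rewrite /face_fun /= Jac_point3// det3_swap opprB.
- apply: (face_coeffs_det3 _ _ _ (bilinear_on_squareB _ _ (Z 1 I1) (Z 0 I0))
    (Z _ e01)) => s t s01 t01.
  by rewrite /face_fun /= Jac_point3// det3_rot.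
Qed.

End Faces.

(** * Boundary of the cube *)

Section Boundary.
Variable R : realType.

Lemma closed_cube : closed (@cube R).
Proof.
have -> : @cube R = \bigcap_(i in [set: 'I_3])
    ((fun p : 'rV[R]_3 => p 0 i) @^-1` `[0, 1]%classic).
  apply/seteqP; split=> p cp i; last by have := cp i Logic.I; rewrite /= in_itv.
  by move=> _ /=; rewrite in_itv; exact: cp.
apply: closed_bigI => i _; apply: preimage_closed => [p _|].
  exact: coord_continuous.
exact: interval_closed.
Qed.

(** Moving by half the radius of a ball both ways along an axis gives the strict bounds; conversely,
    finitely many strict inequalities define a neighbourhood. *)
Lemma interior_cube (q : 'rV[R]_3) :
  (@cube R)^° q <-> forall i, 0 < q 0 i < 1.
Proof.
split=> [/nbhs_ballP[e /= e0 eq] i|q01]; last first.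
  suff : \forall p \near nbhs q, forall i, 0 <= (p : 'rV[R]_3) 0 i <= 1 by [].
  apply: (@filter_forall _ _ (fun i (p : 'rV[R]_3) => 0 <= p 0 i <= 1)) => i.
  have /andP[q0 q1] := q01 i.
  have cq : p 0 i @[p --> q] --> q 0 i.
    exact: coord_continuous.
  near=> p; apply/andP; split; apply: ltW; near: p.
    exact: (cvgr_gt (q 0 i) cq 0 q0).
  exact: (cvgr_lt (q 0 i) cq 1 q1).
have mv (h : R) : `|h| < e -> 0 <= q 0 i + h <= 1.
  move=> he; have /eq/(_ i) : ball q e (q + h *: delta_mx 0 i).
    split=> // k j; rewrite (ord1 k) !mxE /ball /= opprD addNKr normrN.
    by case: eqP => _; rewrite /= ?mulr1// mulr0 normr0.
  by rewrite addr_delta_mx mxE eqxx.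
have e2 : 0 < e / 2%:R by lra.
have := mv (e / 2%:R); rewrite gtr0_norm// => /(_ _)/andP[|_ h1]; first lra.
have := mv (- (e / 2%:R)); rewrite normrN gtr0_norm// => /(_ _)/andP[|h0 _].
  by lra.
by apply/andP; split; lra.
Unshelve. all: by end_near. Qed.

(** This turns the topological boundary into the six faces: a point of the closed cube fails to be
    interior exactly when some coordinate is 0 or 1. *)
Lemma cube_boundaryP (q : 'rV[R]_3) : cube_boundary q <->
  exists phi p, unit_square R p /\ q = face_point phi p.
Proof.
rewrite /cube_boundary -(proj1 (closure_id _) closed_cube).
split=> [[cq nq]|[phi [[s t] [[/= s01 t01] ->]]]].
- have qE : q = point3 (q 0 0) (q 0 1) (q 0 2%:R).
    by apply/rowP => -[[|[|[|//]]] ?]; rewrite mxE;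
      congr (q 0 _); exact: val_inj.
  have end01 i : ~~ (0 < q 0 i < 1) -> exists e : bool, q 0 i = e%:R.
    rewrite negb_and -!leNgt; have /andP[q0 q1] := cq i.
    by case/orP => h; [exists false|exists true]; rewrite /=; lra.
  have [q0|/end01[e qe]] := boolP (0 < q 0 0 < 1); last first.
    by exists (FaceX e), (q 0 1, q 0 2%:R);
      rewrite /= -qe -qE; split => //; split; exact: cq.
  have [q1|/end01[e qe]] := boolP (0 < q 0 1 < 1); last first.
    by exists (FaceY e), (q 0 0, q 0 2%:R);
      rewrite /= -qe -qE; split => //; split; exact: cq.
  have [q2|/end01[e qe]] := boolP (0 < q 0 2%:R < 1); last first.
    by exists (FaceZ e), (q 0 0, q 0 1);
      rewrite /= -qe -qE; split => //; split; exact: cq.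
  exfalso; apply/nq/interior_cube => -[[|[|[|//]]] ?];
    [move: q0|move: q1|move: q2]; congr (0 < q 0 _ < 1); exact: val_inj.
- have out i (e : bool) : (face_point phi (s, t)) 0 i = e%:R ->
      ~ (@cube R)^° (face_point phi (s, t)).
    by move=> E /interior_cube/(_ i); rewrite E; case: (e); rewrite ltxx ?andbF.
  case: phi out => e out; have e01 := natr_bool_itv R e; split.
  + exact: cube_point3.
  + by apply: (out 0 e); rewrite mxE.
  + exact: cube_point3.
  + by apply: (out 1 e); rewrite mxE.
  + exact: cube_point3.
  + by apply: (out 2%:R e); rewrite mxE.
Qed.

Lemma face_argmin (h : face -> R) : exists phi, forall psi, h phi <= h psi.
Proof.
have bool_argmin (g : bool -> R) : exists e, forall e', g e <= g e'.
  have [le|lt] := leP (g true) (g false).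
    by exists true; case.
  by exists false; case=> //; exact: ltW.
have [x hx] := bool_argmin (h \o FaceX).
have [y hy] := bool_argmin (h \o FaceY).
have [z hz] := bool_argmin (h \o FaceZ).
pose m := Num.min (h (FaceX x)) (Num.min (h (FaceY y)) (h (FaceZ z))).
have mle psi : m <= h psi.
  by case: psi => e; rewrite !ge_min ?hx ?hy ?hz ?orbT//.
have : m = h (FaceX x) \/ m = h (FaceY y) \/ m = h (FaceZ z).
  by rewrite /m minEle; case: ifP => _; [left|right; rewrite minEle; case: ifP];
    [..|left|right].
by case=> [E|[E|E]]; [exists (FaceX x)|exists (FaceY y)|exists (FaceZ z)];
  rewrite -E.
Qed.

End Boundary.

(** * Assembly of the face results into the minimum over the boundary *)

Theorem mainTheorem3 (R : realType) (F : 'rV[R]_3 -> 'rV[R]_3)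
    (hF : trilinear F) :
  (forall phi : face,
     let f := face_fun F phi in
     (exists a b c : {poly R}, face_coeffs f a b c) /\
     (forall a b c : {poly R}, face_coeffs f a b c ->
        (size (Ppoly a b c) <= 5)%N) /\
     (candidates f `<=` unit_square R /\
      finite_set (candidates f) /\
      (perimeter_candidates f #<= `I_8)%card /\
      (interior_candidates f #<= `I_4)%card) /\
     (exists m : R, is_min (f @` unit_square R) m /\
                    is_min (f @` candidates f) m)) /\
  finite_set (all_face_candidates F) /\
  (exists p : 'rV[R]_3,
     [/\ all_face_candidates F p, cube_boundary p
       & forall q : 'rV[R]_3, cube_boundary q -> Jac F p <= Jac F q]).
Proof.
have min_face phi : exists2 p, candidates (face_fun F phi) p &
    forall q, unit_square R q -> face_fun F phi p <= face_fun F phi q.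
  have [a [b [c fc]]] := face_coeffs_exist _ _ hF phi.
  exact: candidate_min fc.
split; [|split].
- move=> phi f; have [a [b [c fc]]] := face_coeffs_exist _ _ hF phi.
  split; first by exists a, b, c.
  split; first by move=> a' b' c' [sa sb sc _]; exact: size_Ppoly.
  split.
    split; first exact: candidates_sub_unit_square.
    split; first exact: finite_candidates fc.
    split; first exact: card_perimeter_candidates fc.
    exact: card_interior_candidates fc.
  have [p cp pmin] := min_face phi.
  have Kp := candidates_sub_unit_square _ _ _ cp.
  exists (f p); split; split; try by exists p.
  + by move=> _ [q Kq <-]; exact: pmin.
  + by move=> _ [q cq <-]; apply/pmin/(candidates_sub_unit_square _ f).
- pose C phi : set 'rV[R]_3 := face_point phi @` candidates (face_fun F phi).
  have finC phi : finite_set (C phi).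
    apply: finite_image; have [a [b [c fc]]] := face_coeffs_exist _ _ hF phi.
    exact: finite_candidates fc.
  (* The six faces are grouped as three families indexed by [bool], which gives a finite union. *)
  apply: (@sub_finite_set _ _ (\bigcup_(e in [set: bool])
      (C (FaceX e) `|` C (FaceY e) `|` C (FaceZ e)))).
    move=> q [[e|e|e] Cq]; exists e => //; [left; left|left; right|right];
      exact: Cq.
  by apply: bigcup_finite => // e _; rewrite !finite_setU.
(* One minimizing candidate is chosen on each face; the default [(0, 0)] is never taken, since
   [min_face] provides a witness. *)
- pose m phi := xget (0, 0) [set p | candidates (face_fun F phi) p /\
    forall q, unit_square R q -> face_fun F phi p <= face_fun F phi q].
  have mP phi : candidates (face_fun F phi) (m phi) /\
      forall q, unit_square R q -> face_fun F phi (m phi) <= face_fun F phi q.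
    rewrite /m; case: xgetP => [p _ []//|none].
    by have [p cp pmin] := min_face phi; case: (none p).
  have [phi phi_min] := face_argmin _ (fun psi => face_fun F psi (m psi)).
  have [cm _] := mP phi.
  exists (face_point phi (m phi)); split.
  + by exists phi, (m phi).
  + apply/cube_boundaryP; exists phi, (m phi); split=> //.
    exact: candidates_sub_unit_square cm.
  + move=> _ /cube_boundaryP[psi [p [Kp ->]]].
    by apply: le_trans (phi_min psi) _; exact: (mP psi).2.
Qed.
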